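(* Let $p\geq 2$ be an integer and let $G$ be a finite simple graph which is both $(P_3\cup P_2)$-free and $(2K_1+K_p)$-free, with $\omega(G)\geq 3p-1$. Let $A=\{v_1,\dots,v_\omega\}$ be a maximum clique of $G$ and let $V_1,V_2$ be defined with respect to $A$ as in the context. Then $\langle V_1\rangle$ is a complete graph, $\langle V_2\rangle$ is $P_3$-free, and $G$ is perfect.
   Context: All graphs are finite, simple, undirected. $\omega$ is the clique number; $\langle S\rangle$ is the subgraph induced by $S$. $P_n$ is the path on $n$ vertices, $K_n$ the complete graph, $2K_1$ two isolated vertices; $G_1\cup G_2$ is disjoint union and $G_1+G_2$ the join. A graph is $H$-free if it has no induced subgraph isomorphic to $H$; $G$ is perfect if $\chi(H)=\omega(H)$ for every induced subgraph $H$. Partition: $A=\{v_1,\dots,v_\omega\}$ a maximum clique, $\omega=\omega(G)$; $L=\{(i,j):1\le i<j\le\omega\}$ ordered lexicographically; $C_{i,j}$ is the set of vertices of $V(G)\setminus A$ adjacent to neither $v_i$ nor $v_j$, minus all $C_{i',j'}$ with $(i',j')$ lexicographically earlier; $I_k$ is the set of vertices of $V(G)\setminus A$ adjacent to all $v_i$ with $i\neq k$; $U_k=\{v_k\}\cup I_k$; $V_1=\bigcup_k U_k$; $V_2=\bigcup_{(i,j)\in L}C_{i,j}$. *)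

(* Defs.v *)
From HB Require Import structures.
From mathcomp Require Import all_boot.

Set Implicit Arguments.
Unset Strict Implicit.
Unset Printing Implicit Defensive.

Record sgraph := SGraph {
  vertex :> finType;
  adj : rel vertex;
  adj_sym : symmetric adj;
  adj_irr : irreflexive adj
}.

Section Constructions.

Definition complete_rel n : rel 'I_n := fun i j => i != j.
Lemma complete_sym n : symmetric (@complete_rel n).
Proof. by move=> i j; rewrite /complete_rel eq_sym. Qed.
Lemma complete_irr n : irreflexive (@complete_rel n).
Proof. by move=> i; rewrite /complete_rel eqxx. Qed.
Definition complete_graph n := SGraph (@complete_sym n) (@complete_irr n).

Definition path_rel n : rel 'I_n := fun i j => (i.+1 == j) || (j.+1 == i).
Lemma path_sym n : symmetric (@path_rel n).
Proof. by move=> i j; rewrite /path_rel orbC. Qed.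
Lemma path_irr n : irreflexive (@path_rel n).
Proof. by move=> i; rewrite /path_rel orbb eqn_leq ltnn. Qed.
Definition path_graph n := SGraph (@path_sym n) (@path_irr n).

Variables G H : sgraph.

(* [cross] is the adjacency between the two parts: [false] gives the disjoint
   union, [true] the join. *)
Definition sum_rel (cross : bool) : rel (G + H)%type := fun x y =>
  match x, y with
  | inl a, inl b => adj a b
  | inr a, inr b => adj a b
  | _, _ => cross
  end.
Lemma sum_sym cross : symmetric (sum_rel cross).
Proof. by case=> a [] b //=; rewrite adj_sym. Qed.
Lemma sum_irr cross : irreflexive (sum_rel cross).
Proof. by case=> a /=; rewrite adj_irr. Qed.
Definition disjoint_union := SGraph (sum_sym false) (sum_irr false).
Definition graph_join := SGraph (sum_sym true) (sum_irr true).

Variable S : {set G}.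
Definition induced_rel : rel {x : G | x \in S} := fun x y => adj (val x) (val y).
Lemma induced_sym : symmetric induced_rel.
Proof. by move=> x y; rewrite /induced_rel adj_sym. Qed.
Lemma induced_irr : irreflexive induced_rel.
Proof. by move=> x; rewrite /induced_rel adj_irr. Qed.
Definition induced := SGraph induced_sym induced_irr.

End Constructions.

Definition graph_iso (G H : sgraph) : Prop :=
  exists2 f : G -> H, bijective f & forall x y, adj (f x) (f y) = adj x y.

Definition free (H G : sgraph) : Prop :=
  ~ exists S : {set G}, graph_iso H (induced S).

Definition is_complete (G : sgraph) : Prop :=
  forall x y : G, x != y -> adj x y.

Section Invariants.
Variable G : sgraph.

Definition clique (S : {set G}) : bool :=
  [forall x in S, forall y in S, (x != y) ==> adj x y].

Definition omega : nat := \max_(S : {set G} | clique S) #|S|.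

Definition maximum_clique (A : {set G}) : bool := clique A && (#|A| == omega).

Definition colorable (k : nat) : bool :=
  [exists f : {ffun G -> 'I_k}, forall x, forall y, adj x y ==> (f x != f y)].

Lemma colorable_ex : exists k, colorable k.
Proof.
exists #|G|; apply/existsP; exists [ffun x => enum_rank x].
apply/forallP=> x; apply/forallP=> y; apply/implyP=> xy.
rewrite !ffunE; apply: contraTneq xy => /enum_rank_inj ->.
by rewrite adj_irr.
Qed.

Definition chi : nat := ex_minn colorable_ex.

End Invariants.

Definition perfect (G : sgraph) : Prop :=
  forall S : {set G}, chi (induced S) = omega (induced S).

(* The partition attached to a set [A] enumerated as [v 0, ..., v (n - 1)]
   (indices start at 0 instead of 1). *)
Section Partition.
Variables (G : sgraph) (A : {set G}) (n : nat) (v : 'I_n -> G).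

Definition pairsL : {set 'I_n * 'I_n} := [set ij : 'I_n * 'I_n | ij.1 < ij.2].

Definition lex_lt (s t : 'I_n * 'I_n) : bool :=
  (s.1 < t.1) || (s.1 == t.1) && (s.2 < t.2).

Definition nonadj_both (ij : 'I_n * 'I_n) : {set G} :=
  [set x | [&& x \notin A, ~~ adj x (v ij.1) & ~~ adj x (v ij.2)]].

(* Recursion along the lexicographic order, by fuel: [lex_rank] strictly
   increases along [lex_lt], so the fuel in [partC] is never exhausted and
   [partC] satisfies the defining recursion [partCE]. *)
Fixpoint partC_rec (fuel : nat) (ij : 'I_n * 'I_n) : {set G} :=
  if fuel is m.+1 then
    nonadj_both ij :\: \bigcup_(kl in pairsL | lex_lt kl ij) partC_rec m kl
  else set0.

Definition lex_rank (ij : 'I_n * 'I_n) : nat := ij.1 * n + ij.2.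

Definition partC (ij : 'I_n * 'I_n) : {set G} := partC_rec (lex_rank ij).+1 ij.

Lemma lex_rank_lt s t : lex_lt s t -> lex_rank s < lex_rank t.
Proof.
case: s t => [i j] [k l]; rewrite /lex_lt /lex_rank /=.
case/orP=> [ik|/andP[/eqP-> jl]]; last by rewrite ltn_add2l.
apply: (@leq_trans (i.+1 * n)); first by rewrite mulSn addnC ltn_add2r.
by apply: leq_trans (leq_addr _ _); rewrite leq_mul2r ik orbT.
Qed.

Lemma partC_fuel m m' ij :
  lex_rank ij < m -> lex_rank ij < m' -> partC_rec m ij = partC_rec m' ij.
Proof.
elim: m m' ij => [//|m IH] [//|m'] ij ltm ltm' /=; congr (_ :\: _).
apply: eq_bigr => kl /andP[_ /lex_rank_lt lt_kl].
by apply: IH; apply: leq_trans lt_kl _.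
Qed.

Lemma partCE ij :
  partC ij = nonadj_both ij :\: \bigcup_(kl in pairsL | lex_lt kl ij) partC kl.
Proof.
rewrite {1}/partC /=; congr (_ :\: _).
by apply: eq_bigr => kl /andP[_ /lex_rank_lt lt_kl]; apply: partC_fuel.
Qed.

Definition partI (k : 'I_n) : {set G} :=
  [set x | (x \notin A) && [forall i, (i != k) ==> adj x (v i)]].

Definition partU (k : 'I_n) : {set G} := v k |: partI k.

Definition V1 : {set G} := \bigcup_(k : 'I_n) partU k.

Definition V2 : {set G} := \bigcup_(ij in pairsL) partC ij.

End Partition.

(* Main.v *)
Require Import Defs.
From mathcomp Require Import all_boot zify.

(** Two non-adjacent vertices have fewer than [p] common neighbours in the
    clique [A], so a vertex outside [A] sees at most [p - 1] vertices of [A].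
    As [3 (p - 1) + 2 <= omega], every [I_k] is empty, and an induced P3
    outside [A] would leave an edge of [A] unseen, giving P3 u P2.  Hence [G]
    is a clique together with a disjoint union of cliques, and so is each of
    its induced subgraphs.  Colour [A] injectively with [omega] colours; the
    cliques outside [A] can then be coloured independently of each other.  For
    such a clique [B], a set [Y] of vertices of [B] together with its common
    neighbours in [A] is a clique, which is exactly Hall's condition for
    extending the colouring to [B]. *)

Set Implicit Arguments.
Unset Strict Implicit.
Unset Printing Implicit Defensive.

(** * Hall's marriage theorem *)

(* Rado's argument: as long as some [F x] has two elements, submodularity of
   the size of unions shows that one of them can be removed from [F x]. *)
Lemma hall_marriage (T U : finType) (u0 : U) (X : {set T}) (F : T -> {set U}) :
  (forall Y : {set T}, Y \subset X -> #|Y| <= #|\bigcup_(y in Y) F y|) ->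
  exists2 f : T -> U, {in X &, injective f} & {in X, forall x, f x \in F x}.
Proof.
have [n] := ubnP (\sum_(x in X) #|F x|); elim: n F => // n IH F.
rewrite ltnS => leFn hallF.
have [x /andP[/= xX /card_gt1P[a [b [aF bF ab]]]]|F1] :=
  pickP [pred x in X | 1 < #|F x|]; last first.
  have cardF x : x \in X -> #|F x| = 1.
    move=> xX; apply/eqP; rewrite eqn_leq; apply/andP; split.
      by rewrite leqNgt; have := F1 x; rewrite /= xX /= => ->.
    by have := hallF [set x]; rewrite sub1set xX cards1 big_set1; apply.
  (* [u0] is a mere default: on [X] every [F x] is now a singleton. *)
  pose f x := odflt u0 [pick u in F x].
  have fF x : x \in X -> F x = [set f x].
    move=> /cardF/eqP/cards1P[u Fu]; rewrite Fu /f.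
    by case: pickP => [w|/(_ u)]; rewrite Fu inE ?eqxx // => /eqP->.
  exists f => [x y xX yX fxy|x xX]; last by rewrite fF ?set11.
  apply/eqP/negPn/negP => xy.
  have := hallF [set x; y]; rewrite subUset !sub1set xX yX cards2 xy.
  rewrite bigcup_setU !big_set1 !fF // fxy setUid cards1.
  by move=> /(_ isT).
pose D c y := if y == x then F x :\ c else F y.
have sumD c : c \in F x -> \sum_(y in X) #|D c y| < n.
  move=> cF; apply: leq_trans leFn.
  rewrite (bigD1 x) //= [X in _ < X](bigD1 x) //= {1}/D eqxx.
  rewrite (cardsD1 c (F x)) cF add1n addSn ltnS leq_add2l.
  by apply: leq_sum => y /andP[_ /negPf yx]; rewrite /D yx.
have DF c y : D c y \subset F y.
  by rewrite /D; case: eqP => // ->; apply: subsetDl.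
(* Either Hall's condition survives the removal of [c] and induction applies, or some [Y] violates
   it. Such a [Y] contains [x], since [D c] agrees with [F] elsewhere. *)
have removable c : c \in F x ->
    (exists2 f : T -> U, {in X &, injective f} & {in X, forall x, f x \in F x})
    \/ exists Y : {set T}, [/\ Y \subset X, x \in Y
        & #|(\bigcup_(y in Y :\ x) F y) :|: (F x :\ c)| < #|Y|].
  move=> cF; have [/forallP hallD|] :=
    boolP [forall Y : {set T},
      (Y \subset X) ==> (#|Y| <= #|\bigcup_(y in Y) D c y|)].
    have [|f injf fD] := IH _ (sumD _ cF).
      by move=> Y YX; have := hallD Y; rewrite YX.
    by left; exists f => // y yX; apply: (subsetP (DF c y)); apply: fD.
  rewrite negb_forall => /existsP[Y]; rewrite negb_imply -ltnNge.
  move=> /andP[YX ltY]; right; exists Y.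
  have xY : x \in Y.
    apply: contraLR ltY => xNY; rewrite -leqNgt.
    rewrite (eq_bigr F) ?hallF // => y yY; rewrite /D; case: eqP => // yx.
    by rewrite -yx yY in xNY.
  split=> //; apply: leq_trans ltY; rewrite ltnS.
  rewrite [X in _ <= #|pred_of_set X|](bigD1 x) //= {1}/D eqxx setUC.
  rewrite (_ : \bigcup_(y in Y :\ x) F y
            = \bigcup_(y in Y | y != x) D c y) //.
  apply: eq_big => y; first by rewrite !inE andbC.
  by rewrite !inE /D => /andP[/negPf->].
have [//|[Y1 [Y1X xY1 lt1]]] := removable a aF.
have [//|[Y2 [Y2X xY2 lt2]]] := removable b bF.
(* As [a != b], [N1 :|: N2] contains all of [F x]. Hall's condition for [Y1 :|: Y2] and
   [(Y1 :&: Y2) :\ x] then gives [#|Y1| + #|Y2| - 1 <= #|N1| + #|N2|], while [lt1] and [lt2] bound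
   the right side by [#|Y1| + #|Y2| - 2]. *)
set N1 := _ :|: _ in lt1; set N2 := _ :|: _ in lt2.
have leU : #|Y1 :|: Y2| <= #|N1 :|: N2|.
  apply: leq_trans (hallF _ _) _; first by rewrite subUset Y1X.
  apply/subset_leq_card/bigcupsP => y yY; apply/subsetP=> u uF.
  have [yx|yx] := eqVneq y x.
    rewrite yx in uF; rewrite !inE uF.
    by have [->|_] := eqVneq u a; rewrite ?ab ?orbT.
  move: yY; rewrite inE => /orP[] yY; rewrite !inE.
    rewrite (_ : u \in \bigcup_(y in _) _) //.
    by apply/bigcupP; exists y; rewrite ?inE ?yx.
  rewrite (_ : u \in \bigcup_(y in Y2 :\ x) _) ?orbT //.
  by apply/bigcupP; exists y; rewrite ?inE ?yx.
have leI : #|(Y1 :&: Y2) :\ x| <= #|N1 :&: N2|.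
  apply: leq_trans (hallF _ _) _.
    by apply: subset_trans Y1X; rewrite subDset subsetU // subsetIl orbT.
  apply/subset_leq_card/bigcupsP => y; rewrite !inE => /and3P[yx y1 y2].
  apply/subsetP=> u uF; rewrite !inE.
  apply/andP; split; apply/orP; left; apply/bigcupP; exists y => //.
    by rewrite !inE yx.
  by rewrite !inE yx.
have cI := cardsD1 x (Y1 :&: Y2); rewrite inE xY1 xY2 in cI.
have := cardsUI Y1 Y2; have := cardsUI N1 N2; lia.
Qed.

(** * Cliques and colourings *)

Lemma cliqueP (G : sgraph) (S : {set G}) :
  reflect {in S &, forall x y, x != y -> adj x y} (clique S).
Proof.
apply: (iffP forall_inP) => [h x y xS yS|h x xS].
  by move/forall_inP: (h x xS) => /(_ y yS)/implyP.
by apply/forall_inP=> y yS; apply/implyP; apply: h.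
Qed.

Lemma clique_card_omega (G : sgraph) (S : {set G}) :
  clique S -> #|S| <= omega G.
Proof. exact: (@leq_bigmax_cond _ _ (fun S : {set G} => #|S|)). Qed.

Lemma omega_leq_chi (G : sgraph) : omega G <= chi G.
Proof.
rewrite /chi; case: ex_minnP => k /existsP[f /forallP fP] _.
apply/bigmax_leqP => S /cliqueP cS; rewrite -[k]card_ord.
rewrite -(@card_in_imset _ _ f) ?max_card // => x y xS yS fxy.
apply/eqP/negPn/negP => /(cS _ _ xS yS) xy.
by have /forallP/(_ y) := fP x; rewrite xy fxy eqxx.
Qed.

(** The values of [f] are distinct representatives of the sets [F b] of colours absent from the
    neighbours of [b] in [A]. The bare ['I_k] argument supplies the default colour for
    [hall_marriage]. *)
Lemma extend_clique_coloring (G : sgraph) k (A B : {set G}) (c : G -> 'I_k) :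
    omega G <= k -> clique A -> clique B -> [disjoint A & B] ->
    {in A &, injective c} -> 'I_k ->
  exists2 f : G -> 'I_k, {in B &, injective f}
    & {in A & B, forall a b, adj a b -> c a != f b}.
Proof.
move=> lek cA cB dAB injc i0.
pose F b := ~: (c @: [set a in A | adj a b]).
have [Y YB|f injf fF] := @hall_marriage _ _ i0 B F.
  have [->|[y0 y0Y]] := set_0Vmem Y; first by rewrite cards0.
  pose N := [set a in A | [forall y in Y, adj a y]].
  have NA : N \subset A by apply/subsetP=> a; rewrite inE => /andP[].
  (* A colour outside every [F y] is carried, for each [y], by a neighbour of [y] in [A];
     injectivity of [c] makes this one common neighbour. *)
  have -> : \bigcup_(y in Y) F y = ~: (c @: N).
    apply/setP=> i; rewrite inE; apply/bigcupP/idP => [[y yY]|iN].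
      rewrite inE; apply: contra => /imsetP[a].
      rewrite inE => /andP[aA /forall_inP/(_ _ yY) ay] ->.
      by apply: imset_f; rewrite inE aA.
    apply/exists_inP; apply: contraR iN; rewrite negb_exists_in.
    move=> /forall_inP iF.
    have := iF _ y0Y; rewrite inE negbK => /imsetP[a].
    rewrite inE => /andP[aA _] ia; rewrite ia; apply: imset_f.
    rewrite inE aA; apply/forall_inP => y yY.
    have := iF _ yY; rewrite inE negbK => /imsetP[a'].
    by rewrite inE ia => /andP[a'A a'y] /injc->.
  have := cardsC (c @: N); rewrite card_ord card_in_imset; last first.
    by move=> a a' /(subsetP NA) aA /(subsetP NA); apply: injc.
  have dNY : #|N :&: Y| = 0.
    apply/eqP; rewrite cards_eq0 setI_eq0.
    exact: disjointWl NA (disjointWr YB dAB).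
  have := cardsUI N Y; rewrite dNY.
  (* Hence [#|N| + #|Y| <= omega G <= k], so at least [#|Y|] colours avoid [c @: N]. *)
  have /clique_card_omega : clique (N :|: Y).
    apply/cliqueP=> x y; rewrite !in_setU => /orP[xN|xY] /orP[yN|yY].
    - by apply: (cliqueP _ cA); apply: (subsetP NA).
    - by move: xN; rewrite inE => /andP[_ /forall_inP->].
    - by move: yN; rewrite adj_sym inE => /andP[_ /forall_inP->].
    - by apply: (cliqueP _ cB); apply: (subsetP YB).
  lia.
exists f => // a b aA bB ab; apply: contraTneq (fF b bB) => cf.
by rewrite inE negbK -cf imset_f // inE aA.
Qed.

(** The second hypothesis says that the complement of [A] induces a disjoint union of cliques. [A]
    is any clique, because the trace of a maximum clique on an induced subgraph may fail to be
    maximum there. *)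
Lemma chi_clique_cluster (G : sgraph) (A : {set G}) :
    clique A ->
    (forall x y z, x \notin A -> y \notin A -> z \notin A ->
      adj x y -> adj y z -> x != z -> adj x z) ->
  chi G = omega G.
Proof.
move=> cA trA; apply/eqP; rewrite eqn_leq omega_leq_chi andbT.
suff col : colorable G (omega G).
  by rewrite /chi; case: ex_minnP => k _; apply.
(* Generalising to any [k >= omega G] lets case analysis make [k] a successor, so that [inord] and
   [ord0] exist. *)
have := leqnn (omega G); move: {-1}(omega G) => k lek.
case: (pickP (@predT G)) => [x0 _|G0]; last first.
  apply/existsP; exists [ffun x => False_rect _ (Bool.diff_true_false (G0 x))].
  by apply/forallP=> x; have := G0 x.
case: k lek => [|k] lek.
  have /clique_card_omega : clique [set x0].
    by apply/cliqueP=> x y /set1P-> /set1P->; rewrite eqxx.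
  by rewrite cards1 => /leq_trans/(_ lek).
pose c x : 'I_k.+1 := inord (index x (enum A)).
have injc : {in A &, injective c}.
  have idx x : x \in A -> index x (enum A) < k.+1.
    move=> xA; apply: leq_trans lek; apply: leq_trans (clique_card_omega cA).
    by rewrite cardE index_mem mem_enum.
  move=> x y xA yA /(congr1 val); rewrite /= !inordK ?idx // => exy.
  by rewrite -(nth_index x (_ : x \in enum A)) ?exy ?nth_index ?mem_enum.
(* A boolean specification lets [pick] choose a colouring depending on the set [B] alone, so that
   adjacent vertices outside [A], which by [eqB] have the same [B], share one colouring. *)
pose good (B : {set G}) (f : {ffun G -> 'I_k.+1}) :=
  [forall b in B, [forall b' in B, (f b == f b') ==> (b == b')]
     && [forall a in A, adj a b ==> (c a != f b)]].
pose g B := odflt [ffun=> ord0] [pick f | good B f].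
have gP B : clique B -> [disjoint A & B] ->
    {in B &, injective (g B)} /\ {in A & B, forall a b, adj a b -> c a != g B b}.
  move=> cB dAB; have: good B (g B).
    rewrite /g; case: pickP => //= noB.
    have [f injf fA] := extend_clique_coloring lek cA cB dAB injc ord0.
    have /negP[] := noB (finfun f); apply/forall_inP=> b bB; apply/andP; split.
      apply/forall_inP=> b' b'B; rewrite !ffunE.
      by apply/implyP=> /eqP/injf->.
    by apply/forall_inP=> a aA; rewrite ffunE; apply/implyP; apply: fA.
  move/forall_inP=> gB; split=> [b b' bB b'B e|a b aA bB].
    have /andP[/forall_inP/(_ _ b'B) h _] := gB b bB.
    by apply/eqP; apply: (implyP h); rewrite e.
  by have /andP[_ /forall_inP/(_ _ aA)/implyP] := gB b bB.
(* By [trA] this closed neighbourhood is the whole component of [x] outside [A]. *)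
pose B x := [set y | (y \notin A) && ((y == x) || adj x y)].
have B_self x : x \notin A -> x \in B x by rewrite inE eqxx => ->.
have clB x : x \notin A -> clique (B x).
  move=> xA; apply/cliqueP=> y z; rewrite !inE.
  move=> /andP[yA /orP[/eqP->|xy]] /andP[zA /orP[/eqP->|xz]] //.
  - by rewrite eqxx.
  - by rewrite adj_sym.
  - by apply: (trA y x z) => //; rewrite adj_sym.
have dB x : [disjoint A & B x].
  rewrite disjoint_sym disjoints_subset; apply/subsetP=> y.
  by rewrite !inE => /andP[].
have eqB x y : x \notin A -> y \notin A -> adj x y -> B x = B y.
  move=> xA yA xy; apply/setP=> z; rewrite !inE.
  have [//|zA /=] := boolP (z \in A).
  have [->|zx] := eqVneq z x; first by rewrite adj_sym xy orbT.
  have [->|zy] := eqVneq z y; first by rewrite xy.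
  apply/idP/idP => [xz|yz] /=.
    by apply: (trA y x z) => //; rewrite 1?adj_sym // eq_sym.
  by apply: (trA x y z) => //; rewrite eq_sym.
apply/existsP.
exists [ffun x => if x \in A then c x else g (B x) x].
apply/forallP=> x; apply/forallP=> y; apply/implyP=> xy; rewrite !ffunE.
have Nxy : x != y by apply: contraTneq xy => ->; rewrite adj_irr.
have [xA|xA] := boolP (x \in A); have [yA|yA] := boolP (y \in A).
- by apply: contra_neq Nxy; apply: injc.
- by have [_ ->] := gP _ (clB y yA) (dB y); rewrite ?B_self.
- have [_ h] := gP _ (clB x xA) (dB x).
  by rewrite eq_sym h ?B_self // adj_sym.
- have [inj _] := gP _ (clB x xA) (dB x).
  rewrite -(eqB x y) //; apply: contra_neq Nxy; apply: inj; rewrite ?B_self //.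
  by rewrite (eqB x y) ?B_self.
Qed.

(** * Forbidden induced subgraphs *)

Lemma free_no_embedding (H G : sgraph) (f : H -> G) :
  free H G -> injective f -> ~ (forall x y, adj (f x) (f y) = adj x y).
Proof.
move=> frH injf adjf; apply: frH; exists (f @: [set: H]).
have fI x : f x \in f @: [set: H] by apply: imset_f.
exists (fun x => exist _ (f x) (fI x)) => //.
apply: inj_card_bij => [x y [/injf]//|].
by rewrite /= card_sig card_imset // cardsT.
Qed.

(** Otherwise the five vertices would induce P3 u P2; their adjacencies force them to be distinct,
    apart from [x] and [z], which [xz] separates. *)
Lemma free_P3uP2_no_edge (G : sgraph) (x y z a b : G) :
    free (disjoint_union (path_graph 3) (path_graph 2)) G ->
    adj x y -> adj y z -> x != z -> ~~ adj x z -> adj a b ->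
  [|| adj x a, adj y a, adj z a, adj x b, adj y b | adj z b].
Proof.
move=> fr xy yz xz Nxz ab; apply/negPn/negP.
rewrite !negb_or => /and5P[xa ya za xb /andP[yb zb]].
have sy (u w : G) : ~~ adj u w -> adj w u = false.
  by move=> /negPf; rewrite adj_sym.
pose f (s : disjoint_union (path_graph 3) (path_graph 2)) : G := match s with
  | inl i => nth x [:: x; y; z] i | inr i => nth a [:: a; b] i end.
have adjf s t : adj (f s) (f t) = adj s t.
  case: s t => [[[|[|[|//]]] ?]|[[|[|//]] ?]]
    [[[|[|[|//]]] ?]|[[|[|//]] ?]]; rewrite /= /path_rel /=;
  by rewrite ?adj_irr ?xy ?yz ?ab 1?(adj_sym y x) 1?(adj_sym z y)
     1?(adj_sym b a) ?xy ?yz ?ab ?(negPf Nxz) ?(sy _ _ Nxz)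
     ?(negPf xa) ?(negPf ya) ?(negPf za) ?(negPf xb) ?(negPf yb) ?(negPf zb)
     ?(sy _ _ xa) ?(sy _ _ ya) ?(sy _ _ za) ?(sy _ _ xb) ?(sy _ _ yb)
     ?(sy _ _ zb).
apply: (free_no_embedding fr _ adjf) => s t fst.
(* The two ends of P3 are the only vertices of P3 u P2 with equal
   neighbourhoods. *)
have tw u : adj s u = adj t u by rewrite -!adjf fst.
move: fst (tw (inl (inord 0))) (tw (inl (inord 1))) (tw (inr (inord 0)))
  (tw (inr (inord 1))).
case: s t {tw} => [[[|[|[|//]]] ?]|[[|[|//]] ?]]
    [[[|[|[|//]]] ?]|[[|[|//]] ?]] //= e;
  rewrite /= /path_rel /= ?inordK //= => *;
  try by [congr inl; apply: val_inj | congr inr; apply: val_inj].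
all: by rewrite e eqxx in xz.
Qed.

(** Any [p] vertices of [K] would form, together with [x] and [y], an induced 2K_1 + K_p. *)
Lemma free_2K1jKp_card (G : sgraph) p (x y : G) (K : {set G}) :
    free (graph_join (disjoint_union (complete_graph 1) (complete_graph 1))
                     (complete_graph p)) G ->
    x != y -> ~~ adj x y -> clique K ->
    {in K, forall a, adj x a && adj y a} ->
  #|K| < p.
Proof.
move=> fr xy Nxy /cliqueP cK nK; rewrite ltnNge; apply/negP=> lepK.
pose h (i : 'I_p) := nth x (enum K) i.
have szi (i : 'I_p) : i < size (enum K).
  by rewrite -cardE; apply: leq_trans lepK.
have hK i : h i \in K by rewrite -mem_enum mem_nth.
have injh : injective h.
  by move=> i j /eqP; rewrite nth_uniq ?enum_uniq // => /eqP/val_inj.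
have [nx ny] : (forall i, adj x (h i)) /\ (forall i, adj y (h i)).
  by split=> i; have /andP[] := nK _ (hK i).
pose f (s : graph_join (disjoint_union (complete_graph 1) (complete_graph 1))
                       (complete_graph p)) : G := match s with
  | inl (inl _) => x | inl (inr _) => y | inr i => h i end.
have injf : injective f.
  move=> [[i|i]|i] [[j|j]|j] //= e.
  - by rewrite (ord1 i) (ord1 j).
  - by rewrite e eqxx in xy.
  - by have := nx j; rewrite e adj_irr.
  - by rewrite e eqxx in xy.
  - by rewrite (ord1 i) (ord1 j).
  - by have := ny j; rewrite e adj_irr.
  - by have := nx i; rewrite e adj_irr.
  - by have := ny i; rewrite e adj_irr.
  - by rewrite (injh _ _ e).
apply: (free_no_embedding fr injf).
move=> [[i|i]|i] [[j|j]|j] //=;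
  rewrite ?adj_irr ?nx ?ny ?(negPf Nxy) 1?adj_sym ?nx ?ny ?(negPf Nxy) //.
1,2: by rewrite (ord1 i) (ord1 j).
rewrite /complete_rel; have [->|ij] := eqVneq i j; first by rewrite adj_irr.
by rewrite adj_sym cK ?hK //; apply: contra_neq ij; apply: injh.
Qed.

(** * Structure around a maximum clique *)

Lemma max_clique_nonneighbour (G : sgraph) (A : {set G}) x :
  maximum_clique A -> x \notin A -> exists2 a, a \in A & ~~ adj x a.
Proof.
move=> /andP[/cliqueP cA /eqP szA] xA; apply/exists_inP; apply: contraT.
rewrite negb_exists_in => /forall_inP nx.
have nxA a : a \in A -> adj x a by move/nx; rewrite negbK.
have /clique_card_omega : clique (x |: A).
  apply/cliqueP=> a b /setU1P[->|aA] /setU1P[->|bA].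
  - by rewrite eqxx.
  - by rewrite nxA.
  - by rewrite adj_sym nxA.
  - exact: cA.
by rewrite cardsU1 xA szA add1n ltnn.
Qed.

(** By maximality [x] misses some [b] in [A], and every neighbour of [x] in [A] is a common
    neighbour of the non-adjacent pair [x], [b]. *)
Lemma card_neighbours_max_clique (G : sgraph) p (A : {set G}) x :
    free (graph_join (disjoint_union (complete_graph 1) (complete_graph 1))
                     (complete_graph p)) G ->
    maximum_clique A -> x \notin A ->
  #|[set a in A | adj x a]| < p.
Proof.
move=> fr maxA xA; have [b bA xb] := max_clique_nonneighbour maxA xA.
have cA : clique A by case/andP: maxA.
apply: (free_2K1jKp_card fr _ xb).
- by apply: contraNneq xA => ->.
- apply/cliqueP=> a a'; rewrite !inE => /andP[aA _] /andP[a'A _].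
  exact: (cliqueP _ cA).
- move=> a; rewrite inE => /andP[aA xa]; rewrite xa (cliqueP _ cA) //.
  by apply: contraNneq xb => ->.
Qed.

Theorem theorem4p1 (p : nat) (G : sgraph) (A : {set G}) (v : 'I_(omega G) -> G)
  (p_ge2 : 2 <= p)
  (free_P3uP2 : free (disjoint_union (path_graph 3) (path_graph 2)) G)
  (free_2K1jKp :
     free (graph_join (disjoint_union (complete_graph 1) (complete_graph 1))
                      (complete_graph p)) G)
  (omega_ge : 3 * p - 1 <= omega G)
  (maxA : maximum_clique A)
  (v_inj : injective v)
  (v_enum : A = [set v i | i : 'I_(omega G)]) :
  [/\ is_complete (induced (V1 A v)),
      free (path_graph 3) (induced (V2 A v))
    & perfect G].
Proof.
have [/cliqueP cA /eqP szA] := andP maxA.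
have nbr x : x \notin A -> #|[set a in A | adj x a]| < p.
  exact: card_neighbours_max_clique.
have trA x y z : x \notin A -> y \notin A -> z \notin A ->
    adj x y -> adj y z -> x != z -> adj x z.
  move=> xA yA zA xy yz xz; apply/negPn/negP => Nxz.
  pose N u := [set a in A | adj u a].
  pose R := A :\: (N x :|: N y :|: N z).
  (* The bound on [omega G] enters here: [3 * p - 1 - 3 * (p - 1) = 2]. *)
  have : 1 < #|R|.
    have := nbr x xA; have := nbr y yA; have := nbr z zA.
    rewrite -!/(N _) => Nz Ny Nx.
    have := cardsID (N x :|: N y :|: N z) A; rewrite -/R szA.
    have := subset_leq_card (subsetIr A (N x :|: N y :|: N z)).
    have := cardsU (N x :|: N y) (N z); have := cardsU (N x) (N y).
    lia.
  case/card_gt1P=> a [b [aR bR ab]].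
  have RN u : u \in R -> [/\ u \in A, ~~ adj x u, ~~ adj y u & ~~ adj z u].
    by rewrite !inE => /andP[+ uA]; rewrite uA /= !negb_or => /andP[/andP[]].
  have [aA ax ay az] := RN a aR; have [bA bx b_y bz] := RN b bR.
  have := free_P3uP2_no_edge free_P3uP2 xy yz xz Nxz (cA a b aA bA ab).
  by rewrite (negPf ax) (negPf ay) (negPf az) (negPf bx) (negPf b_y) (negPf bz).
split.
(* A vertex of [partI A v k] would have [omega G - 1 >= p] neighbours in [A], against [nbr]. *)
- have V1A x : x \in V1 A v -> x \in A.
    case/bigcupP=> k _ /setU1P[->|]; first by rewrite v_enum imset_f.
    rewrite inE => /andP[xA /forallP xv]; exfalso.
    have := nbr x xA; rewrite ltnNge => /negP[].
    apply: (@leq_trans #|A :\ v k|).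
      have := cardsD1 (v k) A; rewrite szA v_enum imset_f //; lia.
    apply/subset_leq_card/subsetP => a; rewrite v_enum !inE.
    move=> /andP[avk /imsetP[i _ ai]]; rewrite ai imset_f //=.
    by apply: (implyP (xv i)); apply: contraNneq avk => <-; rewrite ai.
  move=> [x xV] [y yV] xy; apply: cA; rewrite /= ?V1A //.
- have V2A x : x \in V2 A v -> x \notin A.
    case/bigcupP=> ij _; rewrite partCE !inE => /andP[_].
    by case/andP.
  case=> S [f bijf adjf].
  pose w i : G := val (val (f (inord i : 'I_3))).
  have wA i : w i \notin A by apply/V2A/valP.
  have adjw i j : i < 3 -> j < 3 -> adj (w i) (w j) = (i.+1 == j) || (j.+1 == i).
    move=> lti ltj; have := adjf (inord i) (inord j).
    by rewrite /= /path_rel !inordK.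
  (* [adjw] evaluates [adj (w 0) (w 2)] to [false], so [trA] yields a contradiction once
     [w 0 != w 2]. *)
  have := trA (w 0) (w 1) (w 2); rewrite !wA !adjw // => /(_ isT isT isT isT isT).
  suff -> : w 0 != w 2 by move/(_ isT).
  apply/eqP=> /val_inj/val_inj/(bij_inj bijf)/(congr1 val).
  by rewrite /= !inordK.
- move=> S; apply: (@chi_clique_cluster (induced S) [set x | val x \in A]).
    apply/cliqueP=> x y; rewrite !inE => xA yA xy; apply: cA => //.
  move=> x y z; rewrite !inE => xA yA zA xy yz xz.
  exact: (trA (val x) (val y) (val z)).
Qed.
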